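(* Let $\lambda$ be a partition whose $2$-quotient satisfies the shifted condition, fix $Q\in\mathsf{SShDT}(\lambda)$, and let $n$ be the number of dominoes of $Q$. Then \[\sum_{\substack{S\in\mathsf{MSShDT}(\lambda)\\ \mathrm{demark}(S)=Q}}F^B_{\mathrm{Des}(S)}=\Delta^B(\mathrm{Des}(Q)).\]
   Context: Young diagrams in English convention. The $2$-quotient of $\lambda=(\lambda_1,\dots,\lambda_k)$: let $\lambda^\star=(\lambda_i+k-i)_i$; let $w$ be obtained from $\lambda^\star$ by replacing its odd parts, right to left, by $1,3,5,\dots$ and its even parts, right to left, by $0,2,4,\dots$; $\mu$ (resp. $\nu$) is obtained by subtracting position by position the even (resp. odd) entries of $w$ from the even (resp. odd) entries of $\lambda^\star$, halving, removing zeros. Shifted condition: $\mu=(\mu_1,\dots,\mu_p)$, $\nu=(\nu_1,\dots,\nu_q)$ with $\mu_p\ge p$, $\nu_q\ge q$. A domino tiling of $\lambda$ is shifted if no vertical domino $d$ on the main diagonal has all dominoes left of and adjacent to $d$ strictly below the main diagonal. A standard shifted domino tableau of shape $\lambda$ is a bijective filling of the dominoes weakly above the main diagonal of a shifted tiling with $[m]$ ($m$ = number of such dominoes), strictly increasing left to right along rows and top to bottom in columns; $\mathsf{SShDT}(\lambda)$ is their set. A marked one has each entry primed or unprimed; $\mathsf{MSShDT}(\lambda)$ is their set; $\mathrm{demark}(S)$ removes all primes; $\mathrm{dom}_i$ is the domino containing $i$ (or $i'$). For unmarked $Q$ with $n$ dominoes, $i\in[0,n-1]$ is a descent if $i=0$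 and $\mathrm{dom}_1(Q)$ is vertical, or $i>0$ and $\mathrm{dom}_{i+1}(Q)$ is strictly lower than $\mathrm{dom}_i(Q)$ (both its cells in rows strictly below both cells of $\mathrm{dom}_i(Q)$). For marked $S$, $i\in[0,n-1]$ is a descent if: $i=0$ and ($1'$ is in $S$ or $\mathrm{dom}_1(S)$ is vertical); or $i>0$, $i$ is in $S$ unprimed and $i$ is a descent of $\mathrm{demark}(S)$; or $i>0$, $(i+1)'$ is in $S$ and $i$ is not a descent of $\mathrm{demark}(S)$. $\mathrm{Des}$ denotes descent sets. $F^B_I=\sum x_{i_1}\cdots x_{i_n}$ over integers $0=i_0\le i_1\le\cdots\le i_n$ with $i_j<i_{j+1}$ whenever $j\in I$. For $I\subseteq[0,n-1]$: $\mathrm{Peak}^B(I)=\{p\in[n-1]:p\in I,\ p-1\notin I\}$; $\zeta(I)=1$ if $0\in I$ and $0$ otherwise; for $P\subseteq[n-1]$ with no two consecutive integers, $K_{(0,P)}=2^{|P|}\sum_{J\subseteq[0,n-1],\,P\subseteq J\triangle(J+1)}F^B_J$ and, if $1\notin P$, $K_{(1,P)}=2^{|P|+1}\sum_{0\in J\subseteq[0,n-1],\,P\subseteq J\triangle(J+1)}F^B_J$ ($J+1=\{j+1:j\in J\}$); $\Delta^B(I)=K_{(\zeta(I),\mathrm{Peak}^B(I))}$. *)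

(* Defs.v *)
From HB Require Import structures.
From mathcomp Require Import all_boot all_order all_algebra finmap.
From mathcomp Require Export monalg.

Set Implicit Arguments.
Unset Strict Implicit.
Unset Printing Implicit Defensive.

Import GRing.Theory.

Definition is_partition (la : seq nat) : bool :=
  sorted geq la && (0 \notin la).

(* The sequence la_i + k - i for i = 1, ..., k; positions are counted from 0. *)
Definition star (la : seq nat) : seq nat :=
  mkseq (fun i => nth 0 la i + (size la - i.+1)) (size la).

(* The entry of w at position i has the parity of the entry of star la at
   position i, and its rank, counted from the right and starting at 0, among
   the entries of that parity is the number of later ones. *)
Definition wseq (la : seq nat) : seq nat :=
  let s := star la in
  mkseq (fun i =>
    odd (nth 0 s i)
    + (count (fun x => odd x == odd (nth 0 s i)) (drop i.+1 s)).*2) (size s).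

(* b = false gives mu, b = true gives nu. *)
Definition quotient2 (la : seq nat) (b : bool) : seq nat :=
  [seq x <- [seq (p.1 - p.2)./2 | p <- zip (star la) (wseq la) & odd p.1 == b]
   | x != 0].

Definition shifted_part (mu : seq nat) : bool := size mu <= last 0 mu.

Definition shifted_quotient (la : seq nat) : bool :=
  shifted_part (quotient2 la false) && shifted_part (quotient2 la true).

(* Cells are (row, column), rows numbered downwards, both counted from 0. *)

Definition in_diagram (la : seq nat) (c : nat * nat) : bool :=
  c.2 < nth 0 la c.1.

(* ((i, j), v) is the domino whose top left cell is (i, j), vertical iff v.
   The anchor ranges over the bounding rectangle of the diagram. *)
Notation domino la := ('I_(size la) * 'I_(head 0 la) * bool)%type.

(* There are fewer than |la| + 1 dominoes, so this type contains all the
   numbers that may occur in a tableau. *)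
Notation entry la := 'I_(sumn la).+1.

(* (k, true) is k', (k, false) is k. *)
Notation marked_entry la := (entry la * bool)%type.

(* None means that the domino is not filled. The tiling is not recorded: two
   tilings that differ only strictly below the diagonal give the same
   tableaux. *)
Notation filling la A := {ffun domino la -> option A}.

Section Tilings.
Variable la : seq nat.
Implicit Types (d e : domino la) (T : {set domino la}).

Definition vertical d : bool := d.2.

Definition cells d : seq (nat * nat) :=
  let i : nat := d.1.1 in let j : nat := d.1.2 in
  [:: (i, j); if vertical d then (i.+1, j) else (i, j.+1)].

Definition tiling T : bool :=
  [forall (d | d \in T), all (in_diagram la) (cells d)] &&
  [forall i : 'I_(size la), forall j : 'I_(head 0 la),
     in_diagram la (i : nat, j : nat) ==>
     (#|[set d in T | (i : nat, j : nat) \in cells d]| == 1)].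

Definition on_diagonal d : bool := has (fun c => c.1 == c.2) (cells d).

Definition strictly_below d : bool := all (fun c => c.2 < c.1) (cells d).

(* A domino cut by the diagonal counts as weakly above it. *)
Definition weakly_above d : bool := has (fun c => c.1 <= c.2) (cells d).

Definition left_adjacent e d : bool :=
  has (fun c => has (fun c' => (c.1 == c'.1) && (c.2.+1 == c'.2)) (cells d))
      (cells e).

Definition strictly_lower e d : bool :=
  all (fun c => all (fun c' => c'.1 < c.1) (cells d)) (cells e).

(* The forbidden configuration requires at least one domino on the left of d;
   a vertical domino in the top left corner is allowed. *)
Definition shifted_tiling T : bool :=
  tiling T &&
  ~~ [exists (d | d \in T),
       [&& vertical d, on_diagonal d,
           [exists (e | e \in T), left_adjacent e d] &
           [forall (e | e \in T), left_adjacent e d ==> strictly_below e]]].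

Definition before d e : bool :=
  has (fun c => has (fun c' =>
         ((c.1 == c'.1) && (c.2 < c'.2)) || ((c.2 == c'.2) && (c.1 < c'.1)))
       (cells e)) (cells d).


Definition filled (A : finType) (Q : filling la A) : {set domino la} :=
  [set d | Q d != None].

Definition ndom (A : finType) (Q : filling la A) : nat := #|filled Q|.

Definition contains (Q : filling la (entry la)) d (k : nat) : bool :=
  if Q d is Some x then val x == k else false.

Definition standard (Q : filling la (entry la)) : bool :=
  [exists T, shifted_tiling T && (filled Q == [set d in T | weakly_above d])]
  && [forall k : entry la,
       #|[set d | contains Q d (val k)]| == (0 < val k <= ndom Q)]
  && [forall d, forall e, forall k : entry la, forall l : entry la,
       [&& contains Q d (val k), contains Q e (val l), d != e & before d e]
       ==> (val k < val l)].

Definition SShDT : {set filling la (entry la)} :=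
  [set Q | standard Q].

Definition demark (S : filling la (marked_entry la)) : filling la (entry la) :=
  [ffun d => omap fst (S d)].

Definition MSShDT : {set filling la (marked_entry la)} :=
  [set S | demark S \in SShDT].

Definition occurs (S : filling la (marked_entry la)) (k : nat)
    (primed : bool) : bool :=
  [exists d,
     if S d is Some x then (val x.1 == k) && (x.2 == primed) else false].

Definition first_vertical (Q : filling la (entry la)) : bool :=
  [exists d, contains Q d 1 && vertical d].

Definition is_descent (Q : filling la (entry la)) (i : nat) : bool :=
  if i == 0 then first_vertical Q
  else [exists d, exists e,
          [&& contains Q d i, contains Q e i.+1 & strictly_lower e d]].

Definition is_marked_descent (S : filling la (marked_entry la)) (i : nat) :
    bool :=
  if i == 0 then occurs S 1 true || first_vertical (demark S)
  else (occurs S i false && is_descent (demark S) i)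
       || (occurs S i.+1 true && ~~ is_descent (demark S) i).

Definition Des (Q : filling la (entry la)) : {set 'I_(ndom Q)} :=
  [set i : 'I_(ndom Q) | is_descent Q i].

Definition MDes (S : filling la (marked_entry la)) : {set 'I_(ndom S)} :=
  [set i : 'I_(ndom S) | is_marked_descent S i].

End Tilings.

(* Formal power series in x_0, x_1, x_2, ..., given by their coefficients;
   subsets of [0, n-1] are elements of {set 'I_n}. *)

Definition series : Type := {cmonom nat} -> int.

Definition monomial (s : seq nat) : {cmonom nat} :=
  \big[mmul/mone]_(i <- s) ucm i.

Definition admissible (n : nat) (I : {set 'I_n}) (s : seq nat) : bool :=
  [forall j : 'I_n,
     (nth 0 (0 :: s) j <= nth 0 (0 :: s) j.+1)
     && ((j \in I) ==> (nth 0 (0 :: s) j < nth 0 (0 :: s) j.+1))].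

(* The coefficient of m counts the admissible (i_1, ..., i_n) with
   x_{i_1} ... x_{i_n} = m; the entries of such a tuple are in the support
   of m. *)
Definition FB (n : nat) (I : {set 'I_n}) : series := fun m =>
  Posz #|[set t : n.-tuple (finsupp m) |
           admissible I (map val t) && (monomial (map val t) == m)]|.

Section Peaks.
Variable n : nat.
Implicit Types (I J P : {set 'I_n}).

(* (J + 1) without n; it is only intersected with subsets of [n-1]. *)
Definition succs J : {set 'I_n} :=
  [set p : 'I_n | [exists j in J, val p == (val j).+1]].

Definition symdiff I J : {set 'I_n} := (I :\: J) :|: (J :\: I).

Definition has0 I : bool := [exists i in I, val i == 0].

(* p - 1 \notin I is written p \notin I + 1. *)
Definition PeakB I : {set 'I_n} :=
  [set p in I | (0 < val p) && (p \notin succs I)].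

(* KB z P is K_(z, P), with z : bool. It is meaningful only for P without 0
   and without two consecutive elements, and without 1 when z = true. *)
Definition KB (z : bool) P : series := fun m =>
  if z then
    (2 ^+ #|P|.+1 *
     \sum_(J : {set 'I_n} | has0 J && (P \subset symdiff J (succs J))) FB J m)%R
  else
    (2 ^+ #|P| *
     \sum_(J : {set 'I_n} | P \subset symdiff J (succs J)) FB J m)%R.

Definition DeltaB I : series := KB (has0 I) (PeakB I).

End Peaks.

(* Main.v *)
Require Import Defs.
From mathcomp Require Import all_boot all_order all_algebra finmap.

(** A marking of [Q] is a set [E] of primed entries, with [j] in [E] standing
    for the entry [j + 1].  Write [I] for the descent set of [Q] and [J] for
    that of the marked tableau.  Each [j] outside [I] forces the mark of
    [j + 1] (it is primed iff [j] is in [J]), and each [j > 0] in [I] forces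
    the mark of [j] (it is unprimed iff [j] is in [J]); [0] in [I] forces [0]
    in [J].  So the mark of [p] is forced twice exactly when [p] is a peak of
    [I], and the two constraints agree iff exactly one of [p - 1], [p] is in
    [J].  The mark of [j + 1] is free exactly when [j] ends a maximal run of
    consecutive elements of [I]; every run starts either at a peak or at [0],
    so there are [|Peak I| + zeta I] free marks. *)

Import GRing.Theory.

(** * Subsets [I], [E], [J] of ['I_n], without tableaux *)

Section MarkedDescents.
Context {n : nat}.
Implicit Types (I J E : {set 'I_n}) (i j p : 'I_n).

(* The condition [i \notin succs E] also covers [i = 0], which is never in
   [succs E]: if [0] is in [I], it is a descent whatever the marks. *)
Definition marked_descents I E : {set 'I_n} :=
  [set i | if i \in I then i \notin succs E else i \in E].

Definition run_ends I : {set 'I_n} :=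
  [set j in I | [forall p in I, val p != (val j).+1]].

(** The primed entries among the forced ones, as read off from [J]. For [j] in [I], the constraint
    comes from the successor [p] in [I], if there is one. *)
Definition forced_marks I J : {set 'I_n} :=
  [set j | if j \in I
           then [exists p in I, (val p == (val j).+1) && (p \notin J)]
           else j \in J].

Lemma in_succs E j p : val p = (val j).+1 -> (p \in succs E) = (j \in E).
Proof.
move=> pj; rewrite inE; apply/existsP/idP => [[k /andP[kE]]|jE].
  by rewrite pj eqSS => /eqP/val_inj ->.
by exists j; rewrite jE pj eqxx.
Qed.

Lemma succsP E p :
  reflect (exists2 j, j \in E & val p = (val j).+1) (p \in succs E).
Proof.
rewrite inE; apply: (iffP existsP) => [[j /andP[jE /eqP e]]|[j jE e]].
  by exists j.
by exists j; rewrite jE e eqxx.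
Qed.

Lemma ord_predP p : 0 < val p -> exists j, val p = (val j).+1.
Proof.
move=> p0; have lt : (val p).-1 < n by rewrite prednK // ltnW ?ltn_ord.
by exists (Ordinal lt); rewrite /= prednK.
Qed.

(** Removing from [I] the elements with a successor in [I] leaves the run ends; removing those with
    a predecessor in [I] leaves the run starts. The successor map is a bijection between the removed
    sets. *)
Lemma card_run_ends I : #|run_ends I| = #|PeakB I| + has0 I.
Proof.
pose A := [set j in I | [exists p in I, val p == (val j).+1]].
pose B := [set p in I | p \in succs I].
have cardA : #|I| = #|run_ends I| + #|A|.
  rewrite -(cardsID A I) addnC; congr (_ + _).
    apply: eq_card => j; rewrite !inE; case: (j \in I); rewrite ?andbF //=.
    rewrite andbT negb_exists; apply: eq_forallb => p. by case: (p \in I).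
  by apply: eq_card => j; rewrite !inE; case: (j \in I).
have cardB : #|I| = #|PeakB I| + has0 I + #|B|.
  rewrite -(cardsID B I) addnC; congr (_ + _); last first.
    by apply: eq_card => j; rewrite !inE; case: (j \in I).
  rewrite -(cardsID [set p : 'I_n | 0 < val p] (I :\: B)); congr (_ + _).
    apply: eq_card => p; rewrite !inE.
    by case: (p \in I); rewrite ?andbF //= andbT andbC.
  rewrite /has0; case: existsP => [[z /andP[zI /eqP z0]]|no0].
    apply/eqP/cards1P; exists z; apply/setP => p.
    rewrite in_setD in_setD [_ \in B]inE !inE.
    apply/andP/eqP => [[p0 _]|->].
      by apply: val_inj; rewrite [RHS]z0; case: (val p) p0.
    rewrite z0 zI; split => //=; rewrite andbT.
    by apply/existsP => -[j /andP[_ /eqP]].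
  apply/eqP; rewrite cards_eq0; apply/eqP/setP => p.
  rewrite in_setD in_setD [_ \in B]inE !inE.
  apply/negbTE/negP => /andP[p0 /andP[_ pI]]; apply: no0; exists p.
  by rewrite pI; case: (val p) p0.
suff AB : #|B| = #|A| by apply/eqP; rewrite -(eqn_add2r #|A|) -cardA cardB AB.
(* [ordS] is the cyclic successor, hence injective everywhere; it does not wrap around on [A], whose
   elements have a successor in [I]. *)
have ordSE j p : val p = (val j).+1 -> ordS j = p.
  by move=> e; apply: val_inj; rewrite /= -[j.+1]e modn_small ?ltn_ord.
suff -> : B = [set ordS j | j in A] by rewrite card_imset //; apply: ordS_inj.
apply/setP => p; rewrite inE; apply/andP/imsetP => [[pI /succsP[j jI e]]|[j]].
  exists j; last by rewrite (ordSE _ _ e).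
  by rewrite inE jI; apply/existsP; exists p; rewrite pI e eqxx.
rewrite inE => /andP[jI /existsP[k /andP[kI /eqP e]]] ->.
by rewrite (ordSE _ _ e) (in_succs _ _ _ e).
Qed.

Lemma marked_descents_eqP I E J :
  reflect [/\ has0 I ==> has0 J, PeakB I \subset symdiff J (succs J)
            & E :\: run_ends I = forced_marks I J]
          (marked_descents I E == J).
Proof.
apply: (iffP eqP) => [<-|[h0 hP hE]].
  split.
  - apply/implyP => /existsP[i /andP[iI i0]]; apply/existsP; exists i.
    rewrite i0 inE iI andbT; apply/succsP => -[j _].
    by rewrite (eqP i0).
  - apply/subsetP => p; rewrite inE => /and3P[pI p0 pS].
    have [j e] := ord_predP _ p0.
    rewrite (in_succs _ _ _ e) in pS.
    rewrite inE !in_setD !(in_succs _ _ _ e) !inE pI (negbTE pS).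
    have -> : [exists k in E, val p == (val k).+1] = (j \in E).
      by rewrite -(in_succs E _ _ e) inE.
    by case: (j \in E).
  - apply/setP => j; rewrite in_setD [RHS]inE; case: ifP => jI; last first.
      by rewrite !inE jI.
    have [|] := boolP (j \in run_ends I); rewrite inE jI /=.
      move/forallP => noI; apply/esym/existsP => -[p /and3P[pI e _]].
      by have := noI p; rewrite pI e.
    case/forallPn => p; rewrite negb_imply negbK => /andP[pI /eqP e].
    apply/idP/existsP => [jE|[k /and3P[kI /eqP ek]]].
      by exists p; rewrite pI e eqxx inE pI negbK (in_succs _ _ _ e).
    by rewrite inE kI negbK (in_succs _ _ _ ek).
have mem j : j \notin run_ends I -> (j \in E) = (j \in forced_marks I J).
  by move=> jF; rewrite -hE in_setD jF.
apply/setP => i; rewrite inE; case: ifP => iI; last first.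
  by rewrite mem !inE iI.
case: (posnP (val i)) => [i0|ipos].
  have zJ : has0 J.
    by apply: (implyP h0); apply/existsP; exists i; rewrite iI i0.
  have -> : i \in J.
    case/existsP: zJ => k /andP[kJ /eqP k0].
    by rewrite (_ : i = k) //; apply: val_inj; rewrite [LHS]i0 [RHS]k0.
  by apply/succsP => -[j _]; rewrite i0.
have [j e] := ord_predP _ ipos.
rewrite (in_succs _ _ _ e) mem; last first.
  rewrite inE negb_and; apply/orP; right; apply/forallPn; exists i.
  by rewrite iI e eqxx.
rewrite inE; case: ifP => jI.
  apply/negP/idP => [noE|iJ /existsP[k /and3P[_ /eqP ek]]].
    apply/negP => iJ; apply: noE; apply/existsP; exists i.
    by rewrite iI e eqxx; apply/negP.
  by rewrite (_ : k = i) ?iJ //; apply: val_inj; rewrite [LHS]ek [RHS]e.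
(* The mark was read from [j] outside [I]; the peak condition at [i] turns this into the constraint
   coming from [i]. *)
have : i \in PeakB I by rewrite inE iI ipos (in_succs _ _ _ e) jI.
move/(subsetP hP); rewrite inE !in_setD !(in_succs _ _ _ e).
by case: (j \in J); case: (i \in J).
Qed.

(** Each such [E] is [X :|: E0] for a unique [X] in the powerset of [F], recovered by intersecting
    with [F]. *)
Lemma card_setD_eq (T : finType) (F E0 : {set T}) :
  [disjoint E0 & F] -> #|[set E : {set T} | E :\: F == E0]| = 2 ^ #|F|.
Proof.
move=> dis; rewrite -card_powerset.
have E0F : E0 :\: F = E0 by apply/setDidPl.
rewrite -(@card_in_imset _ _ (fun X => X :|: E0) (powerset F)); last first.
  move=> X Y; rewrite !powersetE => XF YF eXY.
  have key (Z : {set T}) : Z \subset F -> (Z :|: E0) :&: F = Z.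
    move=> ZF; rewrite setIUl (setIidPl ZF).
    by move: dis; rewrite -setI_eq0 => /eqP ->; rewrite setU0.
  by rewrite -(key _ XF) eXY key.
apply: eq_card => E; rewrite inE; apply/eqP/imsetP => [<-|[X]].
  by exists (E :&: F); rewrite ?powersetE ?subsetIr // setID.
rewrite powersetE -setD_eq0 => /eqP XF ->.
by rewrite setDUl XF set0U.
Qed.

Lemma card_marked_descents I J :
  #|[set E | marked_descents I E == J]| =
  if (has0 I ==> has0 J) && (PeakB I \subset symdiff J (succs J))
  then 2 ^ (#|PeakB I| + has0 I) else 0.
Proof.
case: ifP => [/andP[h0 hP]|h]; last first.
  apply: eq_card0 => E; rewrite inE.
  apply/negP => /marked_descents_eqP[h0 hP _].
  by rewrite h0 hP in h.
rewrite -card_run_ends -(card_setD_eq _ _ (forced_marks I J)).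
  apply: eq_card => E; rewrite !inE.
  by apply/marked_descents_eqP/eqP => [[]|].
rewrite -setI_eq0; apply/eqP/setP => j; rewrite !inE.
case: (j \in I); rewrite ?andbF //=.
apply/negbTE/negP => /andP[/existsP[p /and3P[pI e _]] /forallP/(_ p)].
by rewrite pI e.
Qed.

Lemma sum_FB_marked_descents I (m : {cmonom nat}) :
  (\sum_(E : {set 'I_n}) FB (marked_descents I E) m)%R = DeltaB I m.
Proof.
rewrite (partition_big (marked_descents I) predT) //=.
pose ok J := (has0 I ==> has0 J) && (PeakB I \subset symdiff J (succs J)).
transitivity (2 ^+ (#|PeakB I| + has0 I) * \sum_(J | ok J) FB J m)%R.
  rewrite mulr_sumr [RHS]big_mkcond /=; apply: eq_bigr => J _.
  transitivity (\sum_(E in [set E | marked_descents I E == J]) FB J m)%R.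
    rewrite [RHS](eq_bigl (fun E => marked_descents I E == J)); last first.
      by move=> E; rewrite inE.
    by apply: eq_bigr => E /eqP ->.
  rewrite sumr_const card_marked_descents -/(ok J); case: (ok J) => //.
  by rewrite -[LHS]mulr_natl natrX.
(* If [0] is in [I], [ok] demands [0] in [J] and the extra free mark gives the exponent [#|P|.+1];
   otherwise the implication is vacuous. *)
by rewrite /DeltaB /KB /ok; case: (has0 I); rewrite ?addn1 ?addn0.
Qed.

End MarkedDescents.

(** * Markings of a fixed tableau as subsets of ['I_n] *)

Section Markings.
Context {la : seq nat} (Q : filling la (entry la)).
Hypothesis Qstd : standard Q.
Notation n := (ndom Q).

Lemma card_contains (k : entry la) :
  #|[set d | contains Q d (val k)]| = (0 < val k <= n).
Proof. by case/andP: Qstd => /andP[_ /forallP/(_ k)/eqP]. Qed.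

(** Ensures that [1], ..., [n] all fit in the type [entry la]. Counting filled dominoes by entry,
    each nonzero entry contributes at most one and [0] none. *)
Lemma ndom_le : n <= sumn la.
Proof.
have -> : n = \sum_(k : entry la) #|[set d | contains Q d (val k)]|.
  rewrite /ndom -sum1_card.
  under [RHS]eq_bigr do rewrite -sum1_card.
  rewrite (exchange_big_dep (fun d => d \in filled Q)) /=; last first.
    by move=> k d _; rewrite !inE /contains; case: (Q d).
  apply: eq_bigr => d; rewrite inE; case Qd: (Q d) => [x|//] _.
  rewrite (big_pred1 x) // => k; rewrite inE /contains Qd /=.
  by rewrite eq_sym.
rewrite big_ord_recl card_contains add0n.
rewrite -[leqRHS]card_ord -sum1_card.
by apply: leq_sum => k _; rewrite card_contains; case: (_ && _).
Qed.

Lemma containsP (i : 'I_n) : exists2 d, contains Q d i.+1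
  & forall e, contains Q e i.+1 -> e = d.
Proof.
have lt : i.+1 < (sumn la).+1 by rewrite ltnS (leq_trans _ ndom_le).
have /eqP := card_contains (Ordinal lt); rewrite /= ltn_ord => /cards1P[d e].
exists d; first by move/setP/(_ d): e; rewrite !inE eqxx.
by move=> f; move/setP/(_ f): e; rewrite !inE => -> /eqP.
Qed.

Lemma entry_bounds d x : Q d = Some x -> 0 < val x <= n.
Proof.
move=> Qd; have := card_contains x; case: (_ && _) => //.
move/eqP; rewrite cards_eq0 => /eqP/setP/(_ d).
by rewrite !inE /contains Qd eqxx.
Qed.

Definition mark (E : {set 'I_n}) : filling la (marked_entry la) :=
  [ffun d => omap (fun x => (x, [exists i in E, val x == i.+1])) (Q d)].

Definition primed (S : filling la (marked_entry la)) : {set 'I_n} :=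
  [set i : 'I_n | occurs S i.+1 true].

Lemma demark_mark E : demark (mark E) = Q.
Proof. by apply/ffunP => d; rewrite !ffunE; case: (Q d). Qed.

Lemma occurs_mark E (i : 'I_n) b : occurs (mark E) i.+1 b = ((i \in E) == b).
Proof.
have mem (x : entry la) : val x = i.+1 ->
    [exists j in E, val x == j.+1] = (i \in E).
  move=> ->; apply/existsP/idP => [[j /andP[jE]]|iE].
    by rewrite eqSS => /eqP/val_inj ->.
  by exists i; rewrite iE eqxx.
apply/existsP/idP => [[d]|iE].
  rewrite ffunE; case: (Q d) => //= x /andP[/eqP e].
  by rewrite mem.
have [d cd _] := containsP i; exists d.
move: cd; rewrite ffunE /contains; case: (Q d) => //= x /eqP e.
by rewrite mem // e eqxx.
Qed.

Lemma markK : cancel mark primed.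
Proof. by move=> E; apply/setP => i; rewrite inE occurs_mark eqb_id. Qed.

Lemma primedK S : demark S = Q -> mark (primed S) = S.
Proof.
move=> SQ; apply/ffunP => d; rewrite ffunE.
have Qd f : Q f = omap fst (S f) by rewrite -SQ ffunE.
rewrite Qd; case Sd: (S d) => [[x b]|] //=; congr (Some (x, _)).
have := Qd d; rewrite Sd /= => Qdx.
have /andP[x0 xn] := entry_bounds _ _ Qdx.
have lt : (val x).-1 < n by rewrite prednK.
pose i : 'I_n := Ordinal lt.
have xi : val x = i.+1 by rewrite /= prednK.
transitivity (i \in primed S).
  apply/existsP/idP => [[j /andP[jE]]|iE]; last by exists i; rewrite iE xi eqxx.
  by rewrite xi eqSS => /eqP/val_inj ->.
rewrite inE; apply/existsP/idP => [[e]|bt]; last first.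
  by exists d; rewrite Sd xi bt !eqxx.
case Se: (S e) => [[y c]|//] /= /andP[/eqP ey /eqP ct].
(* Only one domino carries [i.+1], so the primed occurrence found in [e] is the one in [d]. *)
have [f _ uf] := containsP i.
have ef : e = f by apply: uf; rewrite /contains Qd Se /= ey.
have df : d = f by apply: uf; rewrite /contains Qdx xi.
by move: Se; rewrite ef -df Sd => -[_ ->]; rewrite ct.
Qed.

Lemma is_marked_descent_mark E (i : 'I_n) :
  is_marked_descent (mark E) i = (i \in marked_descents (Des Q) E).
Proof.
rewrite /is_marked_descent demark_mark inE [i \in Des _]inE.
case: (posnP i) => [i0|ipos].
  have -> : is_descent Q i = first_vertical Q.
    by rewrite /is_descent i0.
  have -> : (i \in succs E) = false by apply/succsP => -[j _] /=; rewrite i0.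
  have -> : 1 = i.+1 by rewrite i0.
  rewrite occurs_mark eqb_id.
  by case: (first_vertical Q); rewrite ?orbT ?orbF.
have [j /= e] := ord_predP _ ipos.
(* The mark of entry [i] is indexed by its predecessor [j]. *)
rewrite occurs_mark (in_succs _ _ _ e) eqb_id [in occurs _ i]e.
rewrite occurs_mark eqbF_neg.
by case: (is_descent Q i); rewrite ?andbT ?andbF ?orbF.
Qed.

End Markings.

Lemma ndom_demark {la} (S : filling la (marked_entry la)) :
  ndom (demark S) = ndom S.
Proof. by apply: eq_card => d; rewrite !inE ffunE; case: (S d). Qed.

(** [MDes S] and [Des Q] live in different ordinal types; describing the set by a predicate on [nat]
    avoids a transport. *)
Lemma FB_cast n n' (D : pred nat) (m : {cmonom nat}) :
  n = n' -> FB [set i : 'I_n | D i] m = FB [set i : 'I_n' | D i] m.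
Proof. by move=> ->. Qed.

Theorem theorem4p7 (la : seq nat) (Hla : is_partition la)
    (Hsh : shifted_quotient la)
    (Q : filling la (entry la)) (HQ : Q \in SShDT la) :
  forall m : {cmonom nat},
    (\sum_(S in MSShDT la | demark S == Q) FB (MDes S) m)%R = DeltaB (Des Q) m.
Proof.
move=> m; have Qstd : standard Q by move: HQ; rewrite inE.
rewrite -sum_FB_marked_descents.
(* [mark Q] and [primed Q] are inverse bijections between subsets of ['I_(ndom Q)] and markings of
   [Q]. *)
rewrite (reindex_onto (mark Q) (primed Q)) /=; last first.
  by move=> S /andP[_ /eqP]; apply: (primedK _ Qstd).
apply: eq_big => E.
  by rewrite (markK _ Qstd) inE demark_mark HQ !eqxx.
move=> _; rewrite /MDes (FB_cast _ (ndom Q)); last first.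
  by rewrite -ndom_demark demark_mark.
by congr (FB _ m); apply/setP => i; rewrite inE (is_marked_descent_mark _ Qstd).
Qed.
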